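(* Let $(\Lambda_{i,j})_{i,j\geq 1}$ be a symmetric, nonnegative coagulation kernel. Assume there exist $a_0\in\mathbb{N}$ and $r>1$ such that $\Delta(a)>0$ for all integers $a\geq a_0$, where $\Delta(a):=a\,\inf\{\Lambda_{i,j}: a\leq i,j\leq\lfloor ra\rfloor\}$, and $$\ell:=\sum_{a=a_0}^{\infty}[\Delta(a)]^{-1/2}<\infty.$$ Let $(\omega_i(t))_{i\in\mathbb{N},\,t\geq 0}$ be any solution to the discrete OHS coagulation equations with kernel $\Lambda$ and initial data $(\omega_i^{\mathrm{in}})_{i\ge1}$ satisfying $M_1^{\mathrm{in}}<\infty$ and $$\mu_0:=\sum_{i=a_0+1}^{\infty}(i-a_0)\,\omega_i^{\mathrm{in}}>0.$$ Then gelation occurs in finite time, i.e. $T_{\mathrm{gel}}<\infty$, and the gelation time satisfies $$T_{\mathrm{gel}}\leq\frac{2\,\ell^{2}\left(\frac{r}{r-1}\right)^{2}M_1^{\mathrm{in}}}{\mu_0^{2}}.$$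
   Context: $\mathbb{N}=\{1,2,3,\dots\}$. Given a kernel $\Lambda_{i,j}=\Lambda_{j,i}\geq 0$ ($i,j\in\mathbb{N}$) and initial data $\omega_i^{\mathrm{in}}\geq 0$ ($i\in\mathbb{N}$), the discrete Oort--Hulst--Safronov (OHS) coagulation equations are $$\frac{d\omega_i}{dt}(t)=\omega_{i-1}(t)\sum_{j=1}^{i-1}j\Lambda_{i-1,j}\omega_j(t)-\omega_i(t)\sum_{j=1}^{i}j\Lambda_{i,j}\omega_j(t)-\sum_{j=i}^{\infty}\Lambda_{i,j}\omega_i(t)\omega_j(t),\quad i\in\mathbb{N},$$ with $\omega_i(0)=\omega_i^{\mathrm{in}}$ (the first term is absent, i.e. $0$, when $i=1$). A solution is a family $(\omega_i(t))_{i\in\mathbb{N},t\geq0}$ of nonnegative real numbers such that: for each $i$, $t\mapsto\omega_i(t)$ is locally absolutely continuous on $[0,\infty)$; for every $T>0$ and $i\in\mathbb{N}$, $\int_0^T\big[\omega_i(s)\sum_{j=1}^{i}j\Lambda_{i,j}\omega_j(s)+\omega_i(s)\sum_{j=i}^\infty\Lambda_{i,j}\omega_j(s)\big]ds<\infty$; the equation holds for Lebesgue-a.e. $t\geq0$ and every $i\in\mathbb{N}$; and $\omega_i(0)=\omega_i^{\mathrm{in}}$ for all $i\in\mathbb{N}$. $M_1(t):=\sum_{i=1}^\infty i\,\omega_i(t)$ is the total mass, $M_1^{\mathrm{in}}:=\sum_{i=1}^\infty i\,\omega_i^{\mathrm{in}}$, and the gelation time is $T_{\mathrm{gel}}:=\inf\{t\geq0: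 M_1(t)<M_1^{\mathrm{in}}\}$ (with $\inf\emptyset=+\infty$). *)

(* Defs.v *)
From mathcomp Require Import all_boot all_order all_algebra.
From mathcomp Require Import all_classical all_reals all_analysis.

Set Implicit Arguments.
Unset Strict Implicit.
Unset Printing Implicit Defensive.

Import Order.TTheory GRing.Theory Num.Theory.
Import numFieldNormedType.Exports.

Local Open Scope classical_set_scope.
Local Open Scope ring_scope.

Definition abs_continuous_on (R : realType) (a b : R) (f : R -> R) : Prop :=
  forall e : R, 0 < e -> exists2 d : R, 0 < d &
    forall (n : nat) (x y : 'I_n -> R),
      (forall k, [/\ a <= x k, x k <= y k & y k <= b]) ->
      trivIset [set: 'I_n] (fun k => [set` `]x k, y k[]) ->
      \sum_(k < n) (y k - x k) < d ->
      \sum_(k < n) `|f (y k) - f (x k)| < e.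

Definition loc_abs_continuous (R : realType) (f : R -> R) : Prop :=
  forall T : R, 0 < T -> abs_continuous_on 0 T f.

(* Families indexed by the positive integers are functions on nat of which only
   the values at indices >= 1 are ever constrained or summed; likewise
   functions of time t >= 0 are functions on R, unconstrained for t < 0. *)
Section OHS.
Context (R : realType).
Implicit Types (L : nat -> nat -> R) (w : nat -> R -> R) (win v : nat -> R).

Definition symmetric_nonneg_kernel L : Prop :=
  forall i j, (0 < i)%N -> (0 < j)%N -> 0 <= L i j /\ L i j = L j i.

(* w_i sum_(1 <= j <= i) j L_(i,j) w_j; it vanishes at i = 0 (empty sum), so
   the inflow term below is absent for i = 1. *)
Definition OHS_flux L v (i : nat) : R :=
  v i * \sum_(1 <= j < i.+1) j%:R * L i j * v j.

Record OHS_solution L win w : Prop := OHSSolution {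
  OHS_ge0 : forall (i : nat) (t : R), (0 < i)%N -> 0 <= t -> 0 <= w i t ;
  OHS_loc_ac : forall i, (0 < i)%N -> loc_abs_continuous (w i) ;
  OHS_integrable : forall (T : R) i, 0 < T -> (0 < i)%N ->
    (\int[@lebesgue_measure R]_(s in `[0%R, T])
       ((OHS_flux L (fun k => w k s) i)%:E
        + (w i s)%:E * \sum_(i <= j <oo) (L i j * w j s)%:E) < +oo)%E ;
  (* The left-hand side is finite, so the equation forces the series to
     converge. *)
  OHS_eq : {ae @lebesgue_measure R, forall t : R, 0 <= t -> forall i, (0 < i)%N ->
    derivable (w i) t 1 /\
    (derive1 (w i) t)%:E = ((OHS_flux L (fun k => w k t) i.-1)%:E
                        - (OHS_flux L (fun k => w k t) i)%:E
                        - \sum_(i <= j <oo) (L i j * w i t * w j t)%:E)%E} ;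
  OHS_init : forall i, (0 < i)%N -> w i 0 = win i }.

Definition mass v : \bar R := (\sum_(1 <= i <oo) (i%:R * v i)%:E)%E.

Definition Tgel win w : \bar R :=
  ereal_inf [set t%:E | t in
    [set t : R | 0 <= t /\ (mass (fun i => w i t) < mass win)%E]].

Definition Delta L (r : R) (a : nat) : R :=
  a%:R * inf [set l | exists i j : nat,
    [/\ (a <= i)%N, i%:Z <= Num.floor (r * a%:R),
        (a <= j)%N, j%:Z <= Num.floor (r * a%:R) & l = L i j]].

Definition ell L (r : R) (a0 : nat) : \bar R :=
  (\sum_(a0 <= a <oo) (Delta L r a `^ (- 2^-1))%:E)%E.

Definition mu0 (a0 : nat) win : \bar R :=
  (\sum_(a0.+1 <= i <oo) ((i%:R - a0%:R) * win i)%:E)%E.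

End OHS.

(* Main.v *)
Require Import Defs.
From mathcomp Require Import all_boot all_order all_algebra.
From mathcomp Require Import all_classical all_reals all_analysis.
From mathcomp Require Import ring lra.

Set Implicit Arguments.
Unset Strict Implicit.
Unset Printing Implicit Defensive.

Import Order.TTheory GRing.Theory Num.Theory.
Import numFieldNormedType.Exports.

Local Open Scope classical_set_scope.
Local Open Scope ring_scope.

(** The proof tests the equations with the capped moments
    sum_(i <= n) min(i, a) w_i.  For the test sequence phi_i = min(i, a), a
    pair j <= i contributes L_ij w_i w_j times j (phi_(i+1) - phi_i) - phi_j
    to the time derivative.  This coefficient is 0 for i < a and -min(j, a)
    for i >= a: capping turns the formally conserved mass into a quantity that
    is dissipated at the rate sum_(i >= a) sum_(j <= i) min(j, a) L_ij w_i w_j.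
    Everything that is lost by truncating at n has a favourable sign, so only
    finite sums occur (capped_moment_dissipation).

    The dissipation is at least Delta(a) / 2 * S_a ^ 2, where S_a is the sum of
    w_i over the window a <= i <= r a (dissipation_ge_sqr).  Each i > a0
    belongs to at least (1 - 1/r) (i - a0) of the windows with a >= a0, hence
    the S_a sum up to at least (1 - 1/r) times the moment of i - a0
    (window_sums_ge).

    As long as no mass is lost, that moment stays at least mu0, since the
    moment of min(i, a0) decreases.  This holds uniformly in time for a
    truncated sum: the mass below n is nonincreasing in time, so a truncation
    that keeps almost all the mass at time T keeps as much at all earlier times
    (mass_conserved_bound).

    With the weights c_a = Delta(a)^(-1/2), of total at most ell, the sum of
    c_a times the moment capped at a starts at or below ell M1in, stays >= 0,
    and by the Cauchy-Schwarz inequality decreases at a rate of at least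
    k ^ 2 / (2 ell) with k = (1 - 1/r) mu0 (weighted_dissipation_ge).  Hence
    T k ^ 2 <= 2 ell ^ 2 M1in for every T before gelation.

    The only analysis behind this is that an absolutely continuous function
    whose derivative is at most c almost everywhere grows by at most c (b - a)
    over [a, b] (abs_continuous_ae_le_lin). *)

(** * Absolutely continuous functions with a derivative bound *)

(** Stepping across the supremum of the points of [a, b] that satisfy P shows
    that this supremum is b and that b satisfies P.  Since the step is asked
    for all u <= s <= v near s, this is compactness of [a, b] in the form of
    Cousin's lemma. *)
Lemma real_induction (R : realType) (a b : R) (P : R -> Prop) :
  a <= b -> P a ->
  (forall s, a <= s <= b -> exists2 eta, 0 < eta & forall u v,
     a <= u -> v <= b -> s - eta < u -> u <= s -> s <= v -> v < s + eta ->
     P u -> P v) ->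
  P b.
Proof.
move=> ab Pa step.
pose S := [set x | [/\ a <= x, x <= b & P x]].
have Sa : S a by split.
have Sub : has_sup S by split; [exists a|exists b => x []].
have as_ : a <= sup S by exact: sup_upper_bound.
have sb : sup S <= b by apply: ge_sup; [exists a|move=> x []].
have [eta eta0 next] : exists2 eta, 0 < eta & forall u v,
     a <= u -> v <= b -> sup S - eta < u -> u <= sup S -> sup S <= v ->
     v < sup S + eta -> P u -> P v by apply: step; rewrite as_ sb.
have [u [au ub Pu] su] := sup_adherent eta0 Sub.
have us : u <= sup S by exact: sup_upper_bound.
have [sb'|bs] := ltP (sup S + eta / 2) b; last by apply: (next u b) => //; lra.
have : S (sup S + eta / 2).
  by split; [lra|lra|apply: (next u) => //; lra].
by move/(sup_upper_bound Sub) => ?; exfalso; lra.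
Qed.

(** Both f v - f s and f s - f u are bounded by e times the lengths of the
    corresponding intervals, because the difference quotients at s are close to
    d < e on either side of s. *)
Lemma is_derive_le0_local (R : realType) (f : R -> R) (s d e : R) :
  is_derive s 1 f d -> d <= 0 -> 0 < e ->
  exists2 eta, 0 < eta & forall u v, s - eta < u -> u <= s -> s <= v ->
    v < s + eta -> f v - f u <= e * (v - u).
Proof.
move=> /is_derive1_caratheodory[g [fE gs gsd]] d0 e0.
have : \forall z \near s, g z < e.
  by apply: (cvgr_lt _ gs); rewrite gsd (le_lt_trans d0).
move=> /nbhs_ballP[eta /= eta0 ball_g]; exists eta => // u v su us sv vs.
have gu : g u < e by apply: ball_g; rewrite /ball /= ger0_norm; lra.
have gv : g v < e by apply: ball_g; rewrite /ball /= ler0_norm; lra.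
have := fE u; have := fE v.
have : g v * (v - s) <= e * (v - s) by rewrite ler_wpM2r; lra.
have : g u * (s - u) <= e * (s - u) by rewrite ler_wpM2r; lra.
nra.
Qed.

Lemma sum_length_lt (R : realType) (U : set R) (d : R) (n : nat)
    (x y : 'I_n -> R) :
  open U -> (@lebesgue_measure R U < d%:E)%E ->
  (forall k, x k <= y k) -> (forall k, [set` `]x k, y k[] `<=` U) ->
  trivIset [set: 'I_n] (fun k => [set` `]x k, y k[]) ->
  \sum_(k < n) (y k - x k) < d.
Proof.
move=> oU Ud xy xyU tI.
rewrite -lte_fin; apply: le_lt_trans Ud.
have -> : (\sum_(k < n) (y k - x k))%:E =
    (\sum_(k < n) @lebesgue_measure R [set` `]x k, y k[])%E.
  rewrite -sumEFin; apply: eq_bigr => k _.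
  rewrite lebesgue_measure_itv /= lte_fin.
  by case: ltgtP (xy k) => // -> _; rewrite subrr.
rewrite -measure_bigsetU_ord//=.
apply: le_measure; rewrite ?inE //=.
- by apply: bigsetU_measurable => k _.
- exact: measurable_realfun.open_measurable.
- by apply: (big_ind (fun A => A `<=` U)) => // A B AU BU; rewrite subUset.
Qed.

(** By outer regularity, the null set of exceptional points lies in an open
    set of arbitrarily small measure. *)
Lemma ae_open_cover (R : realType) (P : R -> Prop) (d : R) :
  {ae @lebesgue_measure R, forall t, P t} -> 0 < d ->
  exists U : set R, [/\ open U, (@lebesgue_measure R U < d%:E)%E &
    forall t, ~ U t -> P t].
Proof.
move=> [N [mN N0 PN]] d0.
have N0oo : (@lebesgue_measure R N < +oo)%E by rewrite N0.
have [U [oU NU UN]] := lebesgue_regularity_outer mN N0oo d0.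
exists U; split => //.
- have UE : N `|` (U `\` N) = U. exact: classical_sets.setDUK.
  apply: le_lt_trans UN; rewrite -[X in (_ X <= _)%E]UE.
  have mUN : measurable (U `\` N).
    by apply: measurableD => //; exact: measurable_realfun.open_measurable.
  by rewrite (le_trans (measureU2 _ _ _))// [X in (X + _)%E]N0 add0e.
- by move=> t Ut; apply: contrapT => Pt; apply/Ut/NU/PN.
Qed.

(** The exceptional points are covered by an open set U so small that f moves
    by less than e' along any disjoint intervals inside U.  Real induction along
    [a, b] uses small slopes around the points outside U and collects the
    intervals crossed around the points of U; the total increase is then at most
    e' (b - a) + e'. *)
Lemma abs_continuous_ae_le (R : realType) (f : R -> R) (a b : R) :
  a <= b -> abs_continuous_on a b f ->
  {ae @lebesgue_measure R, forall t, a <= t <= b ->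
    exists2 d, is_derive t 1 f d & d <= 0} ->
  f b <= f a.
Proof.
move=> ab fac fae; apply/ler_addgt0Pl => e e0.
have e'0 : 0 < e / (b - a + 1) by rewrite divr_gt0//; lra.
set e' := e / (b - a + 1) in e'0.
have e'E : e' * (b - a) + e' = e by rewrite /e'; field; lra.
have [d d0 fd] := fac _ e'0.
have [U [oU Ud UP]] := ae_open_cover fae d0.
pose good x (n : nat) (X Y : nat -> R) :=
  [/\ forall k, (k < n)%N -> [/\ a <= X k, X k <= Y k & Y k <= x],
      forall k, (k < n)%N -> [set` `]X k, Y k[] `<=` U,
      forall j k, (j < k < n)%N -> Y j <= X k &
      f x - f a <= e' * (x - a) + \sum_(k < n) `|f (Y k) - f (X k)|].
(* X k and Y k are the end points of the intervals collected so far, listed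
   from left to right. *)
have [n [X [Y [XY XYU YX fb]]]] : exists n X Y, good b n X Y.
  apply: (real_induction (P := fun x => exists n X Y, good x n X Y) ab).
    exists 0%N, (fun _ => 0), (fun _ => 0); split => //.
    by rewrite big_ord0 !subrr mulr0 addr0.
  move=> s sab; have [Us|/UP/(_ sab)[D fD D0]] := pselect (U s); last first.
    have [eta eta0 feta] := is_derive_le0_local fD D0 e'0.
    exists eta => // u v au vb su us sv vs [n [X [Y [XY XYU YX fu]]]].
    exists n, X, Y; split => //.
      by move=> k kn; have [? ? ?] := XY _ kn; split => //; lra.
    by have := feta _ _ su us sv vs; nra.
  have /nbhs_ballP[eta /= eta0 sU] := open_nbhs_nbhs (conj oU Us).
  exists eta => // u v au vb su us sv vs [n [X [Y [XY XYU YX fu]]]].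
  exists n.+1, (fun k => if k == n then u else X k),
    (fun k => if k == n then v else Y k); split.
  - move=> k; rewrite ltnS leq_eqVlt; case: eqP => [_ _|_ /= kn]; first by split; lra.
    by have [? ? ?] := XY _ kn; split => //; lra.
  - move=> k; rewrite ltnS leq_eqVlt; case: eqP => [_ _|_ /= kn]; last exact: XYU.
    move=> z /=; rewrite in_itv /= => /andP[uz zv]; apply: sU.
    by rewrite /ball /= ltr_norml; apply/andP; split; lra.
  - move=> j k /andP[jk]; rewrite ltnS leq_eqVlt.
    have [kE|kn /= ltkn] := eqVneq k n.
      rewrite kE in jk *.
      by move=> _; rewrite (ltn_eqF jk); have [_ _] := XY _ jk; lra.
    by rewrite (ltn_eqF (ltn_trans jk ltkn)); apply: YX; rewrite jk.
  - rewrite big_ord_recr /= eqxx.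
    under eq_bigr => k _ do rewrite (ltn_eqF (ltn_ord k)).
    by have := ler_norm (f v - f u); nra.
apply: (le_trans (y := e' * (b - a) + e' + f a)); last by lra.
rewrite -lerBlDr (le_trans fb)// lerD2l ltW//.
have tI : trivIset [set: 'I_n] (fun k : 'I_n => [set` `]X k, Y k[]).
  apply/trivIsetP => i j _ _.
  have disj (p q : 'I_n) : (p < q)%N ->
      [set` `]X p, Y p[] `&` [set` `]X q, Y q[] = set0.
    move=> pq; rewrite -subset0 => z [] /=; rewrite !in_itv /= => /andP[_ zp] /andP[qz _].
    by have := YX p q; rewrite pq ltn_ord => /(_ isT); lra.
  rewrite neq_ltn => /orP[|] ij; first exact: disj.
  by rewrite setIC disj.
apply: (fd n (fun k => X k) (fun k => Y k)) => //.
  by move=> k; exact: XY.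
apply: (sum_length_lt oU Ud) => // k; last exact: XYU.
by have [] := XY _ (ltn_ord k).
Qed.

Lemma abs_continuous_onS (R : realType) (a b a' b' : R) (f : R -> R) :
  a <= a' -> b' <= b -> abs_continuous_on a b f -> abs_continuous_on a' b' f.
Proof.
move=> aa' b'b fac e /fac[d d0 fd]; exists d => // n x y xy; apply: fd => k.
by have [? ? ?] := xy k; split => //; lra.
Qed.

Lemma abs_continuous_on_id (R : realType) (a b : R) :
  abs_continuous_on a b id.
Proof.
move=> e e0; exists e => // n x y xy _; apply: le_lt_trans.
by apply: ler_sum => k _; rewrite ger0_norm// subr_ge0; have [] := xy k.
Qed.

Lemma abs_continuous_onD (R : realType) (a b : R) (f g : R -> R) :
  abs_continuous_on a b f -> abs_continuous_on a b g ->
  abs_continuous_on a b (fun t => f t + g t).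
Proof.
move=> fac gac e e0; have e20 : 0 < e / 2 by rewrite divr_gt0.
have [d d0 fd] := fac _ e20; have [d' d'0 gd] := gac _ e20.
exists (Num.min d d'); first by rewrite lt_min d0.
move=> n x y xy tI; rewrite lt_min => /andP[/(fd _ _ _ xy tI) ? /(gd _ _ _ xy tI) ?].
have : \sum_(k < n) `|f (y k) + g (y k) - (f (x k) + g (x k))| <=
    \sum_(k < n) `|f (y k) - f (x k)| + \sum_(k < n) `|g (y k) - g (x k)|.
  by rewrite -big_split; apply: ler_sum => k _; rewrite opprD addrACA ler_normD.
lra.
Qed.

Lemma abs_continuous_onZ (R : realType) (a b c : R) (f : R -> R) :
  abs_continuous_on a b f -> abs_continuous_on a b (fun t => c * f t).
Proof.
move=> fac e e0; have ec : 0 < e / (`|c| + 1).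
  by rewrite divr_gt0// ltr_wpDl.
have [d d0 fd] := fac _ ec; exists d => // n x y xy tI /(fd _ _ _ xy tI).
rewrite ltr_pdivlMr ?ltr_wpDl//; apply: le_lt_trans.
rewrite mulr_suml; apply: ler_sum => k _.
by rewrite -mulrBr normrM mulrC ler_wpM2l// lerDl.
Qed.

Lemma abs_continuous_on_sum (R : realType) (I : Type) (s : seq I) (P : pred I)
    (c : I -> R) (f : I -> R -> R) (a b : R) :
  (forall i, P i -> abs_continuous_on a b (f i)) ->
  abs_continuous_on a b (fun t => \sum_(i <- s | P i) c i * f i t).
Proof.
move=> fac; elim: s => [|i s IH].
  have -> : (fun t => \sum_(i <- [::] | P i) c i * f i t) = (fun t : R => 0 * id t).
    by apply/funext => t; rewrite big_nil mul0r.
  exact/abs_continuous_onZ/abs_continuous_on_id.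
have [Pi|nPi] := boolP (P i); last first.
  by under eq_fun => t do rewrite big_cons (negbTE nPi).
under eq_fun => t do rewrite big_cons Pi.
exact: (abs_continuous_onD (abs_continuous_onZ (c i) (fac _ Pi)) IH).
Qed.

Lemma is_derive_lincomb (R : realType) (I : Type) (s : seq I) (P : pred I)
    (c : I -> R) (f : I -> R -> R) (d : I -> R) (t : R) :
  (forall i, P i -> is_derive t 1 (f i) (d i)) ->
  is_derive t 1 (fun u => \sum_(i <- s | P i) c i * f i u)
    (\sum_(i <- s | P i) c i * d i).
Proof.
move=> fd; elim: s => [|i s IH].
  rewrite big_nil.
  have -> : (fun u => \sum_(i <- [::] | P i) c i * f i u) = cst 0.
    by apply/funext => u; rewrite big_nil.
  exact: is_derive_cst.
have [Pi|nPi] := boolP (P i); last first.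
  by under eq_fun => u do rewrite big_cons (negbTE nPi); rewrite big_cons (negbTE nPi).
under eq_fun => u do rewrite big_cons Pi.
rewrite big_cons Pi.
have fi := fd _ Pi.
exact: (is_deriveD (is_deriveZ (c i) fi) IH).
Qed.

Lemma abs_continuous_ae_le_lin (R : realType) (f : R -> R) (a b c : R) :
  a <= b -> abs_continuous_on a b f ->
  {ae @lebesgue_measure R, forall t, a <= t <= b ->
    exists2 d, is_derive t 1 f d & d <= c} ->
  f b - f a <= c * (b - a).
Proof.
move=> ab fac fae.
have gac := abs_continuous_onD fac (abs_continuous_onZ (- c) (abs_continuous_on_id a b)).
suff : f b + - c * b <= f a + - c * a by lra.
apply: (abs_continuous_ae_le ab gac).
move: fae; apply: filterS; first exact: (ae_filter_ringOfSetsType lebesgue_measure).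
move=> t ht /ht[d fd dc].
exists (d + - c * 1); last by lra.
exact: (is_deriveD fd (is_deriveZ (- c) (is_derive_id t 1))).
Qed.

(** * The weak form of the equations on capped moments *)

Lemma sum_triangle (V : nmodType) (F : nat -> nat -> V) (m n : nat) :
  \sum_(m <= i < n) \sum_(i <= j < n) F i j =
  \sum_(m <= j < n) \sum_(m <= i < j.+1) F i j.
Proof.
elim: n => [|n IH]; first by rewrite !big_geq.
have [mn|nm] := leqP m n; last by rewrite !big_geq.
rewrite [RHS]big_nat_recr//= -IH [X in _ + X]big_nat_recr//=.
rewrite [LHS]big_nat_recr//= big_nat1 addrA -big_split/=; congr (_ + _).
by apply: eq_big_nat => i /andP[_ ilen]; rewrite big_nat_recr//= ltnW.
Qed.

Lemma sum_by_parts (R : comRingType) (phi J : nat -> R) (n : nat) : J 0%N = 0 ->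
  \sum_(1 <= i < n.+1) phi i * (J i.-1 - J i) =
  \sum_(1 <= i < n.+1) (phi i.+1 - phi i) * J i - phi n.+1 * J n.
Proof.
move=> J0; elim: n => [|n IH]; first by rewrite !big_geq// J0; ring.
by rewrite ![\sum_(1 <= i < n.+2) _]big_nat_recr//= IH; ring.
Qed.

(** The coefficient of the pair j <= i in the weak form of the equations for
    the test sequence min(i, a): transport from i to i.+1 is exactly balanced
    by the removal of j, unless the cap is active at i. *)
Lemma capped_pair_defect (R : comRingType) (a i j : nat) : (j <= i)%N ->
  ((minn i.+1 a)%:R - (minn i a)%:R) * j%:R - (minn j a)%:R =
  - ((a <= i)%:R * (minn j a)%:R) :> R.
Proof.
move=> ji; have [ai|ia] := leqP a i.
  by rewrite (minn_idPr (leqW ai)) subrr mul0r mul1r sub0r.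
rewrite (minn_idPl ia) (minn_idPl (leq_trans ji (ltnW ia))).
by rewrite -natr1 mul0r; ring.
Qed.

Definition capped_moment (R : realType) (a n : nat) (v : nat -> R) : R :=
  \sum_(1 <= i < n.+1) (minn i a)%:R * v i.

Definition dissipation (R : realType) (L : nat -> nat -> R) (a n : nat)
    (v : nat -> R) : R :=
  \sum_(1 <= i < n.+1) (a <= i)%:R *
    \sum_(1 <= j < i.+1) (minn j a)%:R * (L i j * v i * v j).

(** The weak form of the equations, truncated at n: D plays the role of the
    time derivative of v.  The inequality comes from discarding the flux out of
    n; keeping only the pairs j <= n of the removal term is allowed since the
    hypothesis on D is an upper bound. *)
Lemma capped_moment_dissipation (R : realType) (L : nat -> nat -> R)
    (v D : nat -> R) (a n : nat) :
  symmetric_nonneg_kernel L -> (forall i, (0 < i)%N -> 0 <= v i) ->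
  (forall i, (0 < i <= n)%N ->
    D i <= OHS_flux L v i.-1 - OHS_flux L v i
           - \sum_(i <= j < n.+1) L i j * v i * v j) ->
  capped_moment a n D <= - dissipation L a n v.
Proof.
move=> hL v0 hD; pose phi i : R := (minn i a)%:R.
have phi0 i : 0 <= phi i by [].
have Jge0 i : 0 <= OHS_flux L v i.
  rewrite /OHS_flux; case: i => [|i]; first by rewrite big_geq// mulr0.
  rewrite mulr_ge0 ?v0// big_nat sumr_ge0// => j /andP[j0 _].
  by rewrite !mulr_ge0 ?v0//; have [] := hL i.+1 j isT j0.
have J0 : OHS_flux L v 0%N = 0 by rewrite /OHS_flux big_geq// mulr0.
apply: (le_trans (y := \sum_(1 <= i < n.+1) phi i * (OHS_flux L v i.-1 - OHS_flux L v i)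
   - \sum_(1 <= i < n.+1) \sum_(i <= j < n.+1) phi i * (L i j * v i * v j))).
  rewrite -sumrB /capped_moment [leLHS]big_nat [leRHS]big_nat; apply: ler_sum => i ilen.
  by rewrite -mulr_sumr -mulrBr ler_wpM2l// hD.
rewrite sum_by_parts// sum_triangle.
apply: (le_trans (y := \sum_(1 <= i < n.+1) ((phi i.+1 - phi i) * OHS_flux L v i -
    \sum_(1 <= j < i.+1) phi j * (L j i * v j * v i)))).
  by rewrite sumrB lerD2r lerBlDr lerDl mulr_ge0.
rewrite /dissipation -sumrN le_eqVlt; apply/orP; left; apply/eqP.
apply: eq_big_nat => i /andP[i0 _].
rewrite /OHS_flux !mulr_sumr -sumrB -sumrN.
apply: eq_big_nat => j /andP[j0 ji].
have [_ ->] := hL j i j0 i0.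
transitivity ((((minn i.+1 a)%:R - (minn i a)%:R) * j%:R - (minn j a)%:R) *
  (L i j * v i * v j)); first by rewrite /phi; ring.
by rewrite capped_pair_defect//; ring.
Qed.

Lemma dissipation_ge0 (R : realType) (L : nat -> nat -> R) (v : nat -> R) (a n : nat) :
  symmetric_nonneg_kernel L -> (forall i, (0 < i)%N -> 0 <= v i) ->
  0 <= dissipation L a n v.
Proof.
move=> hL v0; rewrite /dissipation big_nat sumr_ge0// => i /andP[i0 _].
rewrite mulr_ge0// big_nat sumr_ge0// => j /andP[j0 _].
by rewrite !mulr_ge0 ?v0//; have [] := hL i j i0 j0.
Qed.

Lemma sqr_sum_le_triangle (R : realType) (v : nat -> R) (m n : nat) :
  (\sum_(m <= i < n) v i) ^+ 2 <=
  2 * \sum_(m <= i < n) v i * \sum_(m <= j < i.+1) v j.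
Proof.
elim: n => [|n IH]; first by rewrite !big_geq// expr0n mulr0.
have [mn|nm] := leqP m n; last by rewrite !big_geq// expr0n mulr0.
rewrite [X in _ <= _ * X]big_nat_recr//= ![\sum_(m <= i < n.+1) v i]big_nat_recr//=.
by move: IH (sqr_ge0 (v n)); nra.
Qed.

(** Only the pairs in the window [a, n] are kept; there min(j, a) = a, and the
    ordered pairs j <= i carry at least half of the square of the sum. *)
Lemma dissipation_ge_sqr (R : realType) (L : nat -> nat -> R) (v : nat -> R)
    (a n : nat) (l : R) :
  symmetric_nonneg_kernel L -> (forall i, (0 < i)%N -> 0 <= v i) ->
  (0 < a)%N -> 0 <= l ->
  (forall i j, (a <= i <= n)%N -> (a <= j <= n)%N -> l <= L i j) ->
  a%:R * l / 2 * (\sum_(a <= i < n.+1) v i) ^+ 2 <= dissipation L a n v.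
Proof.
move=> hL v0 a0 l0 lL.
have [an|na] := leqP a n; last first.
  by rewrite [X in X ^+ 2]big_geq// expr0n mulr0 dissipation_ge0.
have t0 i j : (0 < i)%N -> (0 < j)%N -> 0 <= L i j * v i * v j.
  by move=> i0 j0; rewrite !mulr_ge0 ?v0//; have [] := hL i j i0 j0.
have hsq := ler_wpM2l (mulr_ge0 (ler0n R a) l0) (sqr_sum_le_triangle v a n.+1).
apply: (le_trans (y := a%:R * l * \sum_(a <= i < n.+1) v i * \sum_(a <= j < i.+1) v j)).
  by lra.
rewrite /dissipation (@big_cat_nat _ _ _ a 1 n.+1)//= ?(leq_trans an)//.
rewrite ler_wpDl//.
  rewrite big_nat sumr_ge0// => i /andP[i0 _].
  by rewrite mulr_ge0// big_nat sumr_ge0// => j /andP[j0 _]; rewrite mulr_ge0// t0.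
rewrite mulr_sumr [leLHS]big_nat [leRHS]big_nat; apply: ler_sum => i /andP[ai ilen].
rewrite ai mul1r (@big_cat_nat _ _ _ a 1 i.+1)//= ?(leq_trans ai)//.
rewrite ler_wpDl//.
  by rewrite big_nat sumr_ge0// => j /andP[j0 _]; rewrite mulr_ge0// t0// (leq_trans a0).
rewrite 2!mulr_sumr [leLHS]big_nat [leRHS]big_nat; apply: ler_sum => j /andP[aj ji].
rewrite (minn_idPr aj).
have : l <= L i j.
  by apply: lL; rewrite ?ai ?aj //= -ltnS (leq_trans ji).
have vi : 0 <= v i by rewrite v0// (leq_trans a0).
have vj : 0 <= v j by rewrite v0// (leq_trans a0).
move=> lij; rewrite -!mulrA ler_wpM2l//.
by rewrite ler_wpM2r// mulr_ge0.
Qed.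

(** * Decay of capped moments along solutions *)

(** Since the removal series has nonnegative terms, its partial sums are enough
    for an upper bound on the derivative.  This keeps all later sums finite. *)
Lemma OHS_ae_slope (R : realType) (L : nat -> nat -> R) (win : nat -> R)
    (w : nat -> R -> R) :
  symmetric_nonneg_kernel L -> OHS_solution L win w ->
  {ae @lebesgue_measure R, forall t : R, 0 <= t -> forall i, (0 < i)%N ->
    is_derive t 1 (w i) (derive1 (w i) t) /\
    forall n, derive1 (w i) t <=
      OHS_flux L (fun k => w k t) i.-1 - OHS_flux L (fun k => w k t) i
      - \sum_(i <= j < n) L i j * w i t * w j t}.
Proof.
move=> hL hw; move: (OHS_eq hw); apply: filterS.
  exact: (ae_filter_ringOfSetsType lebesgue_measure).
move=> t ht t0 i i0; have [dw eqw] := ht t0 i i0.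
split; first by rewrite derive1E; exact: derivableP.
move=> n; rewrite -lee_fin eqw EFinB leeB//.
rewrite -sumEFin; apply: nneseries_lim_ge => j ij _.
have j0 : (0 < j)%N by exact: leq_trans ij.
by rewrite lee_fin !mulr_ge0 ?(OHS_ge0 hw)//; have [] := hL i j i0 j0.
Qed.

(** Several truncated capped moments are combined, with caps a, truncations
    N a and weights c a, because the final argument adds up the dissipations at
    all scales a. *)
Lemma OHS_capped_moments_decay (R : realType) (L : nat -> nat -> R)
    (win : nat -> R) (w : nat -> R -> R) (c : nat -> R) (N : nat -> nat)
    (m n : nat) (s T K : R) :
  symmetric_nonneg_kernel L -> OHS_solution L win w ->
  (forall a, 0 <= c a) -> 0 <= s -> s <= T ->
  (forall t, s <= t <= T ->
     K <= \sum_(m <= a < n) c a * dissipation L a (N a) (fun k => w k t)) ->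
  \sum_(m <= a < n) c a * capped_moment a (N a) (fun k => w k T) + K * (T - s)
  <= \sum_(m <= a < n) c a * capped_moment a (N a) (fun k => w k s).
Proof.
move=> hL hw c0 s0 sT hK.
pose F t := \sum_(m <= a < n) c a * capped_moment a (N a) (fun k => w k t).
suff : F T - F s <= - K * (T - s) by rewrite /F; lra.
apply: abs_continuous_ae_le_lin => //.
  apply: abs_continuous_on_sum => a _; rewrite /capped_moment.
  under eq_fun => t do rewrite big_nat.
  apply: (abs_continuous_on_sum _ (fun i => (minn i a)%:R)) => i /andP[i0 _].
  apply: (@abs_continuous_onS _ 0 (T + 1)); [by []|lra|].
  by apply: (OHS_loc_ac hw) => //; lra.
move: (OHS_ae_slope hL hw); apply: filterS.
  exact: (ae_filter_ringOfSetsType lebesgue_measure).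
move=> t ht stT; have t0 : 0 <= t by lra.
exists (\sum_(m <= a < n) c a * capped_moment a (N a) (fun i => derive1 (w i) t)).
  apply: is_derive_lincomb => a _; rewrite /capped_moment big_nat.
  under eq_fun => u do rewrite big_nat.
  apply: (is_derive_lincomb _ (fun i => (minn i a)%:R)) => i /andP[i0 _].
  by have [] := ht t0 i i0.
rewrite lerNr (le_trans (hK t stT))// -sumrN; apply: ler_sum => a _.
rewrite -mulrN ler_wpM2l// lerNr.
apply: capped_moment_dissipation => // [i i0|i /andP[i0 _]].
  exact: (OHS_ge0 hw).
by have [] := ht t0 i i0.
Qed.

Lemma OHS_capped_moment_nonincreasing (R : realType) (L : nat -> nat -> R)
    (win : nat -> R) (w : nat -> R -> R) (a n : nat) (s t : R) :
  symmetric_nonneg_kernel L -> OHS_solution L win w -> 0 <= s -> s <= t ->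
  capped_moment a n (fun k => w k t) <= capped_moment a n (fun k => w k s).
Proof.
move=> hL hw s0 st.
have := @OHS_capped_moments_decay R L win w (fun=> 1) (fun=> n) a a.+1 s t 0 hL hw.
rewrite !big_nat1 !mul1r mul0r addr0; apply => // u /andP[su _].
rewrite big_nat1 mul1r; apply: dissipation_ge0 => // i i0.
by apply: (OHS_ge0 hw) => //; lra.
Qed.

(** * Counting windows *)

(** The a with a0 <= a <= i <= r a are those from max(a0, i / r) up to i.
    Rounding i / r up costs less than 1, which the closed interval makes up
    for. *)
Lemma count_window_ge (R : realType) (r : R) (a0 i : nat) : 1 < r -> (a0 <= i)%N ->
  (1 - r^-1) * (i - a0)%:R <=
  \sum_(a0 <= a < i.+1) (i <= Num.truncn (r * a%:R))%:R.
Proof.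
move=> r1 a0i; have r0 : 0 < r by lra.
(* m is the first integer above i / r, so all a >= m satisfy i <= r a. *)
pose m := (Num.truncn (i%:R / r)).+1; pose b := maxn a0 m.
have ir0 : 0 <= i%:R / r by rewrite divr_ge0// ltW.
have ir : i%:R / r <= i%:R by rewrite ler_piMr// invf_le1//; lra.
have mir : m%:R <= i%:R / r + 1.
  by rewrite /m -natr1 lerD2r truncn_le.
have mi : (m <= i.+1)%N by rewrite -(ler_nat R) -natr1; lra.
have bi : (b <= i.+1)%N by rewrite geq_max leqW.
rewrite (@big_cat_nat _ _ _ b)//= ?leq_maxl// ler_wpDl ?sumr_ge0//.
have -> : \sum_(b <= a < i.+1) (i <= Num.truncn (r * a%:R))%:R = (i.+1 - b)%:R :> R.
  rewrite -[RHS]mulr1 mulr_natl -sumr_const_nat; apply: eq_big_nat => a /andP[ba _].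
  have -> // : (i <= Num.truncn (r * a%:R))%N.
  rewrite truncn_ge_nat; last by rewrite mulr_ge0// ltW.
  rewrite mulrC -ler_pdivrMr// ltW// (lt_le_trans (truncnS_gt _))// ler_nat.
  exact: leq_trans (leq_maxr _ _) ba.
rewrite !natrB// -natr1.
have q0 : 0 < r^-1 by rewrite invr_gt0.
have q1 : r^-1 < 1 by rewrite invf_lt1.
have ia : (a0%:R : R) <= i%:R by rewrite ler_nat.
have a00 : 0 <= a0%:R :> R by [].
by rewrite /b; case: leqP => _; nra.
Qed.

Lemma window_sums_ge (R : realType) (r : R) (v : nat -> R) (a0 A : nat) :
  1 < r -> (0 < a0)%N -> (forall i, (0 < i)%N -> 0 <= v i) ->
  (1 - r^-1) * \sum_(a0 <= i < A) (i - a0)%:R * v i <=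
  \sum_(a0 <= a < A) \sum_(a <= i < (Num.truncn (r * a%:R)).+1) v i.
Proof.
move=> r1 a00 v0.
apply: (le_trans (y := \sum_(a0 <= a < A) \sum_(a <= i < A)
    (i <= Num.truncn (r * a%:R))%:R * v i)).
  rewrite sum_triangle mulr_sumr [leLHS]big_nat [leRHS]big_nat.
  apply: ler_sum => i /andP[a0i _]; rewrite -mulr_suml mulrA ler_wpM2r//.
    by rewrite v0// (leq_trans a00).
  exact: count_window_ge.
rewrite [leLHS]big_nat [leRHS]big_nat; apply: ler_sum => a /andP[a0a aA].
set N := Num.truncn _.
have aN : (a <= N.+1)%N.
  rewrite leqW// /N truncn_ge_nat; last by rewrite mulr_ge0//; lra.
  by rewrite ler_peMl//; lra.
have v0' i : (a <= i)%N -> 0 <= v i.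
  by move=> ai; rewrite v0// (leq_trans a00)// (leq_trans a0a).
have [AN|NA] := leqP A N.+1.
  rewrite [leRHS](@big_cat_nat _ _ _ A)//= ?(ltnW aA)// ler_wpDr//.
    by rewrite big_nat sumr_ge0// => i /andP[Ai _]; rewrite v0'// (leq_trans (ltnW aA)).
  rewrite [leLHS]big_nat [leRHS]big_nat; apply: ler_sum => i /andP[ai _].
  by rewrite ler_piMl ?v0'//; case: (i <= N)%N.
rewrite (@big_cat_nat _ _ _ N.+1)//= ?(ltnW NA)// [X in _ + X]big_nat.
rewrite [X in _ + X]big1 => [|i /andP[Ni _]]; last first.
  by rewrite leqNgt Ni mul0r.
rewrite addr0 [leLHS]big_nat [leRHS]big_nat; apply: ler_sum => i /andP[ai _].
by rewrite ler_piMl ?v0'//; case: (i <= N)%N.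
Qed.

(** * The bound on the gelation time *)

Lemma nneseries_partial_gt (R : realType) (u : nat -> R) (m : nat) (c : R) :
  (forall i, (m <= i)%N -> 0 <= u i) ->
  (c%:E < \sum_(m <= i <oo) (u i)%:E)%E ->
  exists n0, forall n, (n0 <= n)%N -> c < \sum_(m <= i < n) u i.
Proof.
move=> u0 cu.
have [[n0 hn0]|nex] := pselect (exists n0, c < \sum_(m <= i < n0) u i).
  exists (maxn n0 m) => n; rewrite geq_max => /andP[n0n mn].
  apply: (lt_le_trans hn0).
  have [mn0|n0m] := leqP m n0; last first.
    by rewrite big_geq ?(ltnW n0m)// big_nat sumr_ge0// => i /andP[/u0].
  rewrite [leRHS](@big_cat_nat _ _ _ n0)//= lerDl big_nat sumr_ge0// => i /andP[n0i _].
  by rewrite u0// (leq_trans mn0).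
suff : (\sum_(m <= i <oo) (u i)%:E <= c%:E)%E by rewrite leNgt cu.
apply: lime_le.
  by apply: is_cvg_nneseries => n mn _; rewrite lee_fin u0.
apply: nearW => n; rewrite sumEFin lee_fin leNgt.
by apply/negP => h; apply: nex; exists n.
Qed.

Lemma nneseries_partial_le (R : realType) (u : nat -> R) (m n : nat) :
  (forall i, (m <= i)%N -> 0 <= u i) ->
  (\sum_(m <= i <oo) (u i)%:E < +oo)%E ->
  \sum_(m <= i < n) u i <= fine (\sum_(m <= i <oo) (u i)%:E)%E.
Proof.
move=> u0 uoo.
have ufin : (\sum_(m <= i <oo) (u i)%:E)%E \is a fin_num.
  by rewrite ge0_fin_numE// nneseries_ge0// => i mi _; rewrite lee_fin u0.
by rewrite -lee_fin fineK// -sumEFin nneseries_lim_ge// => i mi _; rewrite lee_fin u0.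
Qed.

(** The window sums need a natural number as end point; truncn (r * a) agrees
    with the integer floor in Delta because r * a is nonnegative. *)
Lemma inf_window_Delta (R : realType) (L : nat -> nat -> R) (r : R) (a : nat) :
  symmetric_nonneg_kernel L -> 1 < r -> (0 < a)%N -> 0 < Delta L r a ->
  exists2 l : R, 0 <= l & Delta L r a = a%:R * l /\
    forall i j, (a <= i <= Num.truncn (r * a%:R))%N ->
      (a <= j <= Num.truncn (r * a%:R))%N -> l <= L i j.
Proof.
move=> hL r1 a0; rewrite /Delta; set S := [set l | _] => D0.
exists (inf S); first by rewrite ltW//; move: D0; rewrite pmulr_rgt0 ?ltr0n.
split=> // i j /andP[ai iN] /andP[aj jN].
have ra : 0 <= r * a%:R by rewrite mulr_ge0//; lra.
have le_floor k : (k <= Num.truncn (r * a%:R))%N -> k%:Z <= Num.floor (r * a%:R).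
  by rewrite truncn_ge_nat// => ?; rewrite floor_ge_int.
apply: ge_inf.
  exists 0 => _ [p [q [ap _ aq _ ->]]].
  by have [] := hL p q (leq_trans a0 ap) (leq_trans a0 aq).
by exists i, j; split => //; exact: le_floor.
Qed.

Lemma le_of_lt_sqr (R : realType) (p mu B : R) : 0 < mu -> 0 <= p ->
  (forall x, 0 < x -> x < mu -> p * x ^+ 2 <= B) -> p * mu ^+ 2 <= B.
Proof.
move=> mu0 p0 h; rewrite leNgt; apply/negP => Bp.
have B0 : 0 <= B.
  by apply: (le_trans _ (h (mu / 2) _ _)); [rewrite mulr_ge0 ?sqr_ge0|lra|lra].
have pgt : 0 < p.
  rewrite lt_neqAle p0 andbT; apply/negP => /eqP pE.
  by move: Bp; rewrite -pE mul0r; lra.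
(* eta is chosen so that lowering mu by eta costs at most half of the gap
   p * mu ^+ 2 - B. *)
pose eta := (p * mu ^+ 2 - B) / (4 * p * mu).
have pmu : 0 < 4 * p * mu by rewrite !mulr_gt0.
have etaE : eta * (4 * p * mu) = p * mu ^+ 2 - B by rewrite divfK// gt_eqF.
have eta0 : 0 < eta by rewrite divr_gt0// subr_gt0.
have etamu : eta <= mu / 4.
  rewrite -(ler_pM2r pmu) etaE; have -> : mu / 4 * (4 * p * mu) = p * mu ^+ 2 by field.
  lra.
have /h : 0 < mu - eta by lra.
have -> : p * (mu - eta) ^+ 2 =
    p * mu ^+ 2 - eta * (4 * p * mu) / 2 + p * eta ^+ 2 by field.
rewrite etaE => /(_ _); have := mulr_ge0 p0 (sqr_ge0 eta).
lra.
Qed.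

Section gelation.
Context (R : realType) (L : nat -> nat -> R) (a0 : nat) (r : R).
Hypotheses (hL : symmetric_nonneg_kernel L) (ha0 : (0 < a0)%N) (hr : 1 < r)
  (hDelta : forall a : nat, (a0 <= a)%N -> 0 < Delta L r a)
  (hell : (ell L r a0 < +oo)%E).

(** The weight given to the moment capped at a; N a is the last index of the
    window at a. *)
Let c (a : nat) : R := Delta L r a `^ (- 2^-1).
Let N (a : nat) : nat := Num.truncn (r * a%:R).

Let c_ge0 a : 0 <= c a. Proof. exact: powR_ge0. Qed.

Let csq a : (a0 <= a)%N -> c a ^+ 2 * Delta L r a = 1.
Proof.
move=> /hDelta D0; rewrite /c powRN exprVn -powR_mulrn ?powR_ge0// -powRrM.
by rewrite mulVf// powRr1 ?ltW// mulVf ?gt_eqF.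
Qed.

Lemma ell_gt0 : 0 < fine (ell L r a0).
Proof.
apply: (@lt_le_trans _ _ (\sum_(a0 <= a < a0.+1) c a)).
  by rewrite big_nat1 powR_gt0// hDelta.
by apply: nneseries_partial_le.
Qed.

(** This is the Cauchy-Schwarz inequality for the sums S_a over the windows,
    with weights c_a such that c_a ^ 2 Delta(a) = 1.  It is used in the
    linearized form c_a Delta(a) S_a ^ 2 >= 2 lam S_a - lam ^ 2 c_a, with the
    optimal lam = k / ell. *)
Lemma weighted_dissipation_ge (v : nat -> R) (A : nat) (k : R) :
  (forall i, (0 < i)%N -> 0 <= v i) -> 0 <= k ->
  k <= \sum_(a0 <= a < A) \sum_(a <= i < (N a).+1) v i ->
  k ^+ 2 / (2 * fine (ell L r a0)) <=
  \sum_(a0 <= a < A) c a * dissipation L a (N a) v.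
Proof.
move=> v0 k0 kS; have l0 := ell_gt0; set l := fine _ in l0 *.
pose lam := k / l; have lam0 : 0 <= lam by rewrite divr_ge0// ltW.
have cl : \sum_(a0 <= a < A) c a <= l by exact: nneseries_partial_le.
apply: (le_trans (y := lam * (\sum_(a0 <= a < A) \sum_(a <= i < (N a).+1) v i) -
    lam ^+ 2 / 2 * \sum_(a0 <= a < A) c a)).
  apply: (le_trans (y := lam * k - lam ^+ 2 / 2 * l)).
    rewrite le_eqVlt; apply/orP; left; apply/eqP; rewrite /lam; field.
    by rewrite gt_eqF.
  by apply: lerB; apply: ler_wpM2l => //; rewrite divr_ge0// sqr_ge0.
rewrite !mulr_sumr -sumrB [leLHS]big_nat [leRHS]big_nat; apply: ler_sum => a /andP[a0a _].
have [ll ll0 [DE lL]] := inf_window_Delta hL hr (leq_trans ha0 a0a) (hDelta a0a).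
have := dissipation_ge_sqr hL v0 (leq_trans ha0 a0a) ll0 lL.
rewrite -/(N a) -DE; set S := \sum_(a <= i < _) v i => hS.
apply: (le_trans _ (ler_wpM2l (c_ge0 a) hS)).
have := csq a0a; have := c_ge0 a; have := hDelta a0a.
set D := Delta _ _ _; set x := c a => D0 x0 xD.
have : 0 <= x * D * (S - lam * x) ^+ 2.
  by apply: mulr_ge0; [apply: mulr_ge0 => //; exact: ltW|exact: sqr_ge0].
have -> : x * D * (S - lam * x) ^+ 2 =
  x * D * S ^+ 2 - 2 * lam * S * (x ^+ 2 * D) + lam ^+ 2 * x * (x ^+ 2 * D) by ring.
by rewrite xD; lra.
Qed.

Variables (win : nat -> R) (w : nat -> R -> R).
Hypotheses (hwin : forall i : nat, (0 < i)%N -> 0 <= win i)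
  (hw : OHS_solution L win w) (hM : (mass win < +oo)%E).

Lemma capped_moment_le_mass (a n : nat) : capped_moment a n win <= fine (mass win).
Proof.
apply: (le_trans (y := \sum_(1 <= i < n.+1) i%:R * win i)).
  rewrite /capped_moment [leLHS]big_nat [leRHS]big_nat; apply: ler_sum => i /andP[i0 _].
  by rewrite ler_wpM2r ?hwin// ler_nat geq_minl.
by apply: nneseries_partial_le => // i i0; rewrite mulr_ge0// hwin.
Qed.

Lemma OHS_init_capped (a n : nat) :
  capped_moment a n (fun i => w i 0) = capped_moment a n win.
Proof.
by apply: eq_big_nat => i /andP[i0 _]; rewrite (OHS_init hw).
Qed.

Lemma mass_split_at (v : nat -> R) (n : nat) :
  \sum_(1 <= i < n.+1) i%:R * v i =
  capped_moment a0 n v + \sum_(a0 <= i < n.+1) (i - a0)%:R * v i.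
Proof.
have -> : \sum_(a0 <= i < n.+1) (i - a0)%:R * v i =
    \sum_(1 <= i < n.+1) (i - a0)%:R * v i.
  have [an|na] := leqP a0 n.+1.
    rewrite [RHS](@big_cat_nat _ _ _ a0)//= [X in X + _]big_nat [X in X + _]big1 ?add0r//.
    move=> i /andP[_ ia]; rewrite (eqP (_ : (i - a0)%N == 0%N)) ?mul0r//.
    by rewrite subn_eq0 ltnW.
  rewrite big_geq ?(ltnW na)// big_nat big1// => i /andP[_ ilen].
  rewrite (eqP (_ : (i - a0)%N == 0%N)) ?mul0r// subn_eq0.
  by rewrite ltnW// (ltn_trans ilen).
rewrite -big_split; apply: eq_bigr => i _ /=; rewrite -mulrDl -natrD.
by rewrite minnE subnK// leq_subr.
Qed.

(** The bound for a time T at which no mass has been lost, for any x below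
    mu0.  The slack between x and mu0 pays for truncating both the initial
    moment of i - a0 and the mass at time T. *)
Lemma mass_conserved_bound (T x : R) : 0 <= T ->
  (mass win <= mass (fun i => w i T))%E -> 0 < x -> (x%:E < mu0 a0 win)%E ->
  T * ((1 - r^-1) * x) ^+ 2 <= 2 * fine (ell L r a0) ^+ 2 * fine (mass win).
Proof.
move=> T0 mT x0 xmu; set l := fine (ell _ _ _); set M := fine (mass win).
have l0 : 0 < l by exact: ell_gt0.
have ME : mass win = M%:E.
  rewrite fineK// ge0_fin_numE// nneseries_ge0// => i i0 _.
  by rewrite lee_fin mulr_ge0// hwin.
have q0 : 0 < 1 - r^-1 by rewrite subr_gt0 invf_lt1// (lt_trans ltr01).
have [y xy ymu] : exists2 y, x < y & (y%:E < mu0 a0 win)%E.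
  move: xmu; case: (mu0 a0 win) => [z| |] //; rewrite ?lte_fin => xz.
    by exists ((x + z) / 2); rewrite ?lte_fin; lra.
  by exists (x + 1); rewrite ?ltry//; lra.
have [n1 hn1] : exists n0, forall n, (n0 <= n)%N ->
    y < \sum_(a0.+1 <= i < n) (i%:R - a0%:R) * win i.
  apply: nneseries_partial_gt ymu => i ia.
  by rewrite mulr_ge0 ?hwin ?(leq_trans _ ia)// subr_ge0 ler_nat ltnW.
have [n2 hn2] : exists n0, forall n, (n0 <= n)%N ->
    M - (y - x) < \sum_(1 <= i < n) i%:R * w i T.
  apply: nneseries_partial_gt => [i i0|].
    by rewrite mulr_ge0// (OHS_ge0 hw).
  by apply: lt_le_trans mT; rewrite ME lte_fin; lra.
pose n := maxn a0 (maxn n1 n2); pose A := n.+1.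
have a0n : (a0 <= n)%N by rewrite leq_maxl.
have {}hn1 : y < \sum_(a0 <= i < A) (i - a0)%:R * win i.
  rewrite big_ltn ?ltnS// subnn mul0r add0r.
  rewrite (eq_big_nat _ _ (F2 := fun i => (i%:R - a0%:R) * win i)).
    by apply: hn1; rewrite leqW ?leq_max ?leqnn ?orbT.
  by move=> i /andP[ia _]; rewrite natrB// ltnW.
have {}hn2 : M - (y - x) < \sum_(1 <= i < A) i%:R * w i T.
  by apply: hn2; rewrite leqW ?leq_max ?leqnn ?orbT.
have hMA : \sum_(1 <= i < A) i%:R * win i <= M.
  by apply: nneseries_partial_le => // i i0; rewrite mulr_ge0// hwin.
(* Mass below A has dropped to no less than M - (y - x) by time T, hence at all
   times up to T. *)
have hx t : 0 <= t <= T -> x <= \sum_(a0 <= i < A) (i - a0)%:R * w i t.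
  move=> /andP[t0 tT].
  have decr := OHS_capped_moment_nonincreasing a0 n hL hw (lexx 0) t0.
  have decrT := OHS_capped_moment_nonincreasing n n hL hw t0 tT.
  have full u : capped_moment n n (fun i => w i u) = \sum_(1 <= i < A) i%:R * w i u.
    apply: eq_big_nat => i /andP[_ ilen].
    by rewrite (minn_idPl (_ : (i <= n)%N)).
  move: decr decrT; rewrite !full (OHS_init_capped a0 n).
  have := mass_split_at (fun i => w i t) n; have := mass_split_at win n.
  by rewrite -/A; lra.
pose k := (1 - r^-1) * x.
have k0 : 0 <= k by rewrite mulr_ge0// ltW.
have := @OHS_capped_moments_decay R L win w c N a0 A 0 T (k ^+ 2 / (2 * l))
  hL hw c_ge0 (lexx 0) T0.
have w0 t : 0 <= t -> forall i, (0 < i)%N -> 0 <= w i t.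
  by move=> t0 i i0; rewrite (OHS_ge0 hw).
have -> : \sum_(a0 <= a < A) c a * capped_moment a (N a) (fun i => w i 0) =
    \sum_(a0 <= a < A) c a * capped_moment a (N a) win.
  by apply: eq_bigr => a _; rewrite OHS_init_capped.
have F0 : \sum_(a0 <= a < A) c a * capped_moment a (N a) win <= l * M.
  apply: (le_trans (y := \sum_(a0 <= a < A) c a * M)).
    by apply: ler_sum => a _; rewrite ler_wpM2l ?c_ge0// capped_moment_le_mass.
  rewrite -mulr_suml ler_wpM2r//; last exact: nneseries_partial_le.
  by rewrite -lee_fin -ME nneseries_ge0// => i i0 _; rewrite lee_fin mulr_ge0// hwin.
have FT : 0 <= \sum_(a0 <= a < A) c a * capped_moment a (N a) (fun i => w i T).
  apply: sumr_ge0 => a _; rewrite mulr_ge0 ?c_ge0// /capped_moment big_nat.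
  by apply: sumr_ge0 => i /andP[i0 _]; rewrite mulr_ge0// w0.
have hdis t : 0 <= t <= T -> k ^+ 2 / (2 * l) <=
    \sum_(a0 <= a < A) c a * dissipation L a (N a) (fun i => w i t).
  move=> tT; have /andP[t0 _] := tT.
  apply: weighted_dissipation_ge => //; first exact: w0.
  apply: le_trans (window_sums_ge A hr ha0 (w0 t t0)).
  by rewrite ler_wpM2l ?hx// ltW.
move=> /(_ hdis); rewrite subr0 => hF.
have {}hF : k ^+ 2 / (2 * l) * T <= l * M by lra.
have -> : T * k ^+ 2 = 2 * l * (k ^+ 2 / (2 * l) * T) by field; rewrite gt_eqF.
have -> : 2 * l ^+ 2 * M = 2 * l * (l * M) by ring.
by rewrite ler_wpM2l// mulr_ge0// ltW.
Qed.

End gelation.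

Theorem theorem3p1 (R : realType) (L : nat -> nat -> R)
    (hL : symmetric_nonneg_kernel L)
    (a0 : nat) (r : R) (ha0 : (0 < a0)%N) (hr : 1 < r)
    (hDelta : forall a : nat, (a0 <= a)%N -> 0 < Delta L r a)
    (hell : (ell L r a0 < +oo)%E)
    (win : nat -> R) (hwin : forall i : nat, (0 < i)%N -> 0 <= win i)
    (w : nat -> R -> R) (hw : OHS_solution L win w)
    (hM : (mass win < +oo)%E) (hmu : (0 < mu0 a0 win)%E) :
  (Tgel win w < +oo)%E /\
  (Tgel win w <=
   (2 * fine (ell L r a0) ^+ 2 * (r / (r - 1)) ^+ 2 * fine (mass win)
    / fine (mu0 a0 win) ^+ 2)%:E)%E.
Proof.
set B := _ / _ ^+ 2.
suff TB : (Tgel win w <= B%:E)%E by split => //; exact: le_lt_trans TB (ltry _).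
rewrite leNgt; apply/negP => BT.
have u0 i : (a0.+1 <= i)%N -> 0 <= (i%:R - a0%:R) * win i.
  by move=> ia; rewrite mulr_ge0 ?hwin ?(leq_trans _ ia)// subr_ge0 ler_nat ltnW.
have muE : mu0 a0 win = (fine (mu0 a0 win))%:E.
  rewrite fineK// ge0_fin_numE ?ltW//.
  apply: (@le_lt_trans _ _ (fine (mass win))%:E); last exact: ltry.
  rewrite leNgt; apply/negP => /(nneseries_partial_gt u0)[n /(_ n (leqnn n))].
  apply/negP; rewrite -leNgt.
  apply: le_trans (@nneseries_partial_le R (fun i => i%:R * win i) 1 n _ hM); last first.
    by move=> i i0; rewrite mulr_ge0// hwin.
  have [na|an] := leqP n a0.+1.
    by rewrite big_geq// big_nat sumr_ge0// => i /andP[i0 _]; rewrite mulr_ge0// hwin.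
  rewrite [leRHS](@big_cat_nat _ _ _ a0.+1)//= ?(ltnW an)// ler_wpDl//.
    by rewrite big_nat sumr_ge0// => i /andP[i0 _]; rewrite mulr_ge0// hwin.
  rewrite [leLHS]big_nat [leRHS]big_nat; apply: ler_sum => i /andP[ia _].
  by rewrite ler_wpM2r ?hwin ?(leq_trans _ ia)// lerBlDr lerDl.
set mu := fine (mu0 a0 win) in muE *.
have mu_gt0 : 0 < mu by rewrite -lte_fin -muE.
have M0 : 0 <= fine (mass win).
  by rewrite fine_ge0// nneseries_ge0// => i i0 _; rewrite lee_fin mulr_ge0// hwin.
have B0 : 0 <= B.
  apply: divr_ge0; last exact: sqr_ge0.
  apply: mulr_ge0 => //; apply: mulr_ge0; last exact: sqr_ge0.
  by apply: mulr_ge0 => //; exact: sqr_ge0.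
have [T BltT TT] : exists2 T, B < T & (T%:E < Tgel win w)%E.
  move: BT; case: (Tgel win w) => [z| |] //; rewrite ?lte_fin => Bz.
    by exists ((B + z) / 2); rewrite ?lte_fin; lra.
  by exists (B + 1); rewrite ?ltry//; lra.
have T0 : 0 <= T by lra.
have mT : (mass win <= mass (fun i => w i T))%E.
  rewrite leNgt; apply/negP => hT; move: TT; rewrite ltNge => /negP; apply.
  by apply: ereal_inf_lbound; exists T.
have q0 : 0 < 1 - r^-1 by rewrite subr_gt0 invf_lt1// (lt_trans ltr01).
have : T * (1 - r^-1) ^+ 2 * mu ^+ 2 <= 2 * fine (ell L r a0) ^+ 2 * fine (mass win).
  apply: le_of_lt_sqr => //; first by rewrite mulr_ge0 ?sqr_ge0.
  move=> x x0 xmu; rewrite -(mulrA T) -exprMn.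
  apply: (mass_conserved_bound hL ha0 hr hDelta hell hwin hw hM) => //.
  by rewrite muE lte_fin.
apply/negP; rewrite -ltNge.
have -> : 2 * fine (ell L r a0) ^+ 2 * fine (mass win) = B * ((1 - r^-1) ^+ 2 * mu ^+ 2).
  rewrite /B -/mu; field.
  by rewrite !gt_eqF//; lra.
by rewrite -mulrA ltr_pM2r// mulr_gt0 ?exprn_gt0.
Qed.
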